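(* Let $G$ be a residually finite group acting properly discontinuously and cocompactly by isometries on a complete $\mathrm{CAT}(0)$ space $X$. Suppose there exists a finite subgroup $H < G$ such that the set of fixed points $\{x \in X \mid hx = x \text{ for all } h \in H\}$ is bounded. Then the quotient map $\mathrm{Aut}(G) \to \mathrm{Out}(G)$ splits virtually. In particular $\mathrm{Out}(G)$ is residually finite.
   Context: For a group $G$, $\mathrm{Inn}(G)$ is the group of inner automorphisms and $\mathrm{Out}(G) = \mathrm{Aut}(G)/\mathrm{Inn}(G)$. A group epimorphism $f : A \to B$ splits virtually if there exist a finite index subgroup $B' < B$ and a homomorphism $g : B' \to A$ with $f \circ g = \mathrm{Id}_{B'}$. A group is residually finite if the intersection of its finite index subgroups is trivial. *)

(* Defs.v *)
From HB Require Import structures.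
From mathcomp Require Import all_boot all_order all_algebra.
From mathcomp Require Import all_classical all_reals all_analysis.

Set Implicit Arguments.
Unset Strict Implicit.
Unset Printing Implicit Defensive.

Import Order.TTheory GRing.Theory Num.Theory.

Local Open Scope classical_set_scope.
Local Open Scope quotient_scope.
Local Open Scope ring_scope.

Section Groups.
Local Open Scope group_scope.

Definition is_subgroup (G : groupType) (H : set G) : Prop :=
  group_closed [in H].

Definition lcoset_set (G : groupType) (H : set G) (g : G) : set G :=
  [set g * h | h in H].

Definition finite_index (G : groupType) (H : set G) : Prop :=
  finite_set (range (lcoset_set H)).

Definition residually_finite (G : groupType) : Prop :=
  \bigcap_(H in [set H : set G | is_subgroup H /\ finite_index H]) H
    = [set 1].

(** A homomorphism defined on a subgroup [B'] is represented by a total function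
    whose values outside [B'] are irrelevant. *)
Definition splits_virtually (A B : groupType) (f : {multiplicative A -> B}) :
    Prop :=
  exists B' : set B, [/\ is_subgroup B', finite_index B' &
    exists g : B -> A,
      {in B' &, {morph g : x y / x * y}} /\ {in B', forall b, f (g b) = b}].

Definition is_normal (G : groupType) (N : set G) : Prop :=
  is_subgroup N /\ forall x y, N x -> N (x ^ y).

End Groups.

Section QuotientGroup.
Local Open Scope group_scope.
Variables (G : groupType) (N : set G) (nN : is_normal N).

Definition coset_eq (x y : G) : bool := `[< N (x^-1 * y) >].

Let N1 : N 1.
Proof. by case: nN => -[+ _] _; rewrite inE. Qed.

Let NF x y : N x -> N y -> N (x / y).
Proof.
move=> Nx Ny; case: nN => -[_ h] _.
by have := h x y; rewrite !inE; apply.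
Qed.

Let NV x : N x -> N x^-1.
Proof. by move=> /(NF N1); rewrite mul1g. Qed.

Let NM x y : N x -> N y -> N (x * y).
Proof. by move=> Nx /NV /(NF Nx); rewrite invgK. Qed.

Let NJ x y : N x -> N (x ^ y).
Proof. by case: nN => _; apply. Qed.

Lemma coset_eq_equiv : equiv_class_of coset_eq.
Proof.
split=> [x|x y|y x z].
- by apply/asboolP; rewrite mulVg.
- by apply/asboolP/asboolP => /NV; rewrite invgM invgK.
- by move=> /asboolP xy /asboolP yz; apply/asboolP;
     have := NM xy yz; rewrite mulgA mulgK.
Qed.

Definition coset_equiv := EquivRelPack coset_eq_equiv.

Definition quotient_group := {eq_quot coset_equiv}.

HB.instance Definition _ := Choice.on quotient_group.
HB.instance Definition _ := EqQuotient.on quotient_group.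

Definition quotient_map : G -> quotient_group := \pi_quotient_group.

Lemma quotient_mapP x y : quotient_map x = quotient_map y <-> N (x^-1 * y).
Proof.
split=> [/eqP|h]; first by rewrite /quotient_map eqmodE => /asboolP.
by apply/eqP; rewrite /quotient_map eqmodE; apply/asboolP.
Qed.

Lemma quotient_map_repr (a : quotient_group) : quotient_map (repr a) = a.
Proof. exact: reprK. Qed.

Lemma quotient_map_surj (a : quotient_group) : exists x, quotient_map x = a.
Proof. by exists (repr a); exact: quotient_map_repr. Qed.

Definition quotient_one : quotient_group := quotient_map 1.
Definition quotient_inv (a : quotient_group) : quotient_group :=
  quotient_map (repr a)^-1.
Definition quotient_mul (a b : quotient_group) : quotient_group :=
  quotient_map (repr a * repr b).

Lemma quotient_mapM x y :
  quotient_map (x * y) = quotient_mul (quotient_map x) (quotient_map y).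
Proof.
rewrite /quotient_mul; set x' := repr _; set y' := repr _.
have hx : N (x^-1 * x').
  by apply/quotient_mapP; rewrite quotient_map_repr.
have hy : N (y^-1 * y').
  by apply/quotient_mapP; rewrite quotient_map_repr.
apply/quotient_mapP.
have := NM (NJ y hx) hy.
by rewrite /conjg invgM !mulgA mulgK.
Qed.

Lemma quotient_mapV x : quotient_map x^-1 = quotient_inv (quotient_map x).
Proof.
rewrite /quotient_inv; set x' := repr _.
have hx : N (x'^-1 * x).
  by apply/quotient_mapP; rewrite quotient_map_repr.
apply/quotient_mapP; have := NJ x^-1 hx.
by rewrite /conjg !invgK !mulgA mulgK.
Qed.

Lemma quotient_mulA : associative quotient_mul.
Proof.
move=> a b c.
rewrite -(quotient_map_repr a) -(quotient_map_repr b) -(quotient_map_repr c).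
by rewrite -!quotient_mapM mulgA.
Qed.

Lemma quotient_mul1 : left_id quotient_one quotient_mul.
Proof.
by move=> a; rewrite -(quotient_map_repr a) -quotient_mapM mul1g.
Qed.

Lemma quotient_mulr1 : right_id quotient_one quotient_mul.
Proof.
by move=> a; rewrite -(quotient_map_repr a) -quotient_mapM mulg1.
Qed.

Lemma quotient_mulV : left_inverse quotient_one quotient_inv quotient_mul.
Proof.
by move=> a; rewrite -(quotient_map_repr a) -quotient_mapV -quotient_mapM mulVg.
Qed.

Lemma quotient_mulrV : right_inverse quotient_one quotient_inv quotient_mul.
Proof.
by move=> a; rewrite -(quotient_map_repr a) -quotient_mapV -quotient_mapM mulgV.
Qed.

HB.instance Definition _ := isGroup.Build quotient_group
  quotient_mulA quotient_mul1 quotient_mulr1 quotient_mulV quotient_mulrV.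

HB.instance Definition _ :=
  isMultiplicative.Build G quotient_group quotient_map quotient_mapM.

End QuotientGroup.

Section Automorphisms.
Local Open Scope group_scope.
Variable G : groupType.

(** The inverse is carried as data only to make the group operations direct:
    it is determined by the underlying function, see [autP]. *)
Record Aut : Type := MkAut {
  aut_fun :> G -> G;
  aut_finv : G -> G;
  autM : {morph aut_fun : x y / x * y};
  autK : cancel aut_fun aut_finv;
  autVK : cancel aut_finv aut_fun }.

Lemma autP (f g : Aut) : f =1 g -> f = g.
Proof.
case: f g => [f f' fM fK f'K] [g g' gM gK g'K] /= /funext fg.
move: fM fK f'K; rewrite {f}fg => fM fK f'K.
have fg' : f' = g' by apply/funext => x; rewrite -{1}(g'K x) fK.
move: fK f'K; rewrite {f'}fg' => fK f'K.
by congr MkAut; exact: Prop_irrelevance.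
Qed.

Lemma ex_aut (f : G -> G) :
  {morph f : x y / x * y} -> bijective f -> exists a : Aut, aut_fun a = f.
Proof. by move=> fM [f' fK f'K]; exists (MkAut fM fK f'K). Qed.

HB.instance Definition _ := gen_eqMixin Aut.
HB.instance Definition _ := gen_choiceMixin Aut.

Definition aut_one : Aut :=
  @MkAut idfun idfun (fun _ _ => erefl) (fun _ => erefl) (fun _ => erefl).

Lemma aut_finvM (f : Aut) : {morph aut_finv f : x y / x * y}.
Proof. by move=> x y; apply: (can_inj (@autK f)); rewrite autM !autVK. Qed.

Definition aut_inv (f : Aut) : Aut :=
  MkAut (aut_finvM f) (@autVK f) (@autK f).

Lemma aut_compM (f g : Aut) : {morph f \o g : x y / x * y}.
Proof. by move=> x y; rewrite /= !autM. Qed.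

Definition aut_mul (f g : Aut) : Aut :=
  MkAut (aut_compM f g) (can_comp (@autK f) (@autK g))
    (can_comp (@autVK g) (@autVK f)).

Lemma aut_mulA : associative aut_mul.
Proof. by move=> f g h; exact: autP. Qed.

Lemma aut_mul1 : left_id aut_one aut_mul.
Proof. by move=> f; exact: autP. Qed.

Lemma aut_mulr1 : right_id aut_one aut_mul.
Proof. by move=> f; exact: autP. Qed.

Lemma aut_mulV : left_inverse aut_one aut_inv aut_mul.
Proof. by move=> f; apply: autP => x /=; rewrite autK. Qed.

Lemma aut_mulrV : right_inverse aut_one aut_inv aut_mul.
Proof. by move=> f; apply: autP => x /=; rewrite autVK. Qed.

HB.instance Definition _ := isGroup.Build Aut
  aut_mulA aut_mul1 aut_mulr1 aut_mulV aut_mulrV.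

Definition Inn : set Aut :=
  [set f | exists g : G, forall x, f x = g * x * g^-1].

Lemma Inn_normal : is_normal Inn.
Proof.
split; first split.
- by rewrite inE; exists 1 => x; rewrite mul1g invg1 mulg1.
- move=> f h; rewrite !inE => -[a fa] [b hb]; exists (a / b) => x.
  have -> : (f / h) x = f (aut_finv h x) by [].
  have -> : aut_finv h x = b^-1 * x * b.
    by apply: (can_inj (@autK h)); rewrite autVK hb !mulgA mulgV mul1g mulgK.
  by rewrite fa invgM invgK !mulgA.
- move=> f h [a fa]; exists (aut_finv h a) => x.
  have -> : (f ^ h) x = aut_finv h (f (h x)) by [].
  rewrite fa; apply: (can_inj (@autK h)); rewrite autVK !autM autVK.
  congr (_ * _); apply: (mulgI a); rewrite mulgV -[X in X * _](autVK h a).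
  rewrite -autM mulgV; apply/esym.
  by apply: (mulgI (h 1)); rewrite -autM !mulg1.
Qed.

Definition Out : groupType := quotient_group Inn_normal.

Definition Aut_to_Out : {multiplicative Aut -> Out} :=
  @quotient_map Aut Inn Inn_normal.

Lemma Aut_to_Out_surj (a : Out) : exists f, Aut_to_Out f = a.
Proof. exact: quotient_map_surj. Qed.

End Automorphisms.

(** Completeness is that of the library's [completeType], which is pointed: the
    spaces considered are nonempty. *)
#[short(type="completeMetricType")]
HB.structure Definition CompleteMetric (R : realType) :=
  {X of Metric R X & Complete X}.

Section CAT0.
Variable R : realType.

(** The Euclidean distance; the norm that the library puts on ['rV[R]_2] is the
    maximum norm. *)
Definition edist (a b : 'rV[R]_2) : R :=
  Num.sqrt (\sum_(i < 2) (a 0 i - b 0 i) ^+ 2).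

Definition segment_point (a b : 'rV[R]_2) (u : R) : 'rV[R]_2 :=
  (1 - u) *: a + u *: b.

Variable X : metricType R.

(** Geodesics are parametrized by arc length on [[0, d(x, y)]]; the values
    outside this interval are irrelevant. *)
Definition geodesic (x y : X) (c : R -> X) : Prop :=
  [/\ c 0 = x, c (mdist x y) = y &
      {in `[0, mdist x y] &, forall s t, mdist (c s) (c t) = `|s - t|}].

Definition geodesic_space : Prop := forall x y : X, exists c, geodesic x y c.

(** Side [i] of a triangle joins vertex [i] to vertex [ordS i], the next one
    cyclically. *)
Definition geodesic_triangle (v : 'I_3 -> X) (c : 'I_3 -> R -> X) : Prop :=
  forall i, geodesic (v i) (v (ordS i)) (c i).

Definition comparison_triangle (v : 'I_3 -> X) (w : 'I_3 -> 'rV[R]_2) : Prop :=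
  forall i j, edist (w i) (w j) = mdist (v i) (v j).

(** The point of the comparison triangle corresponding to [c i s]: the point of
    the segment from [w i] to [w (ordS i)] at distance [s] from [w i].  For a
    degenerate side, [s = 0] and the quotient is [0]. *)
Definition comparison_point (v : 'I_3 -> X) (w : 'I_3 -> 'rV[R]_2)
    (i : 'I_3) (s : R) : 'rV[R]_2 :=
  segment_point (w i) (w (ordS i)) (s / mdist (v i) (v (ordS i))).

Definition CAT0_space : Prop :=
  geodesic_space /\
  forall v c w, geodesic_triangle v c -> comparison_triangle v w ->
  forall i j s t,
    s \in `[0, mdist (v i) (v (ordS i))] ->
    t \in `[0, mdist (v j) (v (ordS j))] ->
    mdist (c i s) (c j t)
      <= edist (comparison_point v w i s) (comparison_point v w j t).

Definition bounded_subset (A : set X) : Prop :=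
  exists M : R, forall x y, A x -> A y -> mdist x y <= M.

End CAT0.

Section Actions.
Variables (R : realType) (G : groupType) (X : metricType R).
Variable act : G -> X -> X.

Record isometric_action : Prop := {
  act_one : forall x, act 1%g x = x;
  act_mul : forall g h x, act (g * h)%g x = act g (act h x);
  act_isometry : forall g x y, mdist (act g x) (act g y) = mdist x y }.

Definition properly_discontinuous : Prop :=
  forall K : set X, compact K ->
    finite_set [set g : G | (act g @` K) `&` K !=set0].

Definition cocompact : Prop :=
  exists K : set X, compact K /\ \bigcup_(g in [set: G]) (act g @` K) = setT.

Definition fixed_points (H : set G) : set X :=
  [set x | forall h, H h -> act h x = x].

End Actions.

(* Main.v *)
Require Import Defs.
From mathcomp Require Import finmap all_boot all_order all_algebra.
From mathcomp Require Import all_classical all_reals all_analysis.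
From mathcomp Require Import ring lra.

Set Implicit Arguments.
Unset Strict Implicit.
Unset Printing Implicit Defensive.

Import Order.TTheory GRing.Theory Num.Theory.

(** The geometry is used for three facts about [G].

    - [G] is generated by a finite set [T].  Since the action is cocompact and
      properly discontinuous, a neighbourhood of uniform radius of the compact
      set [K] is covered by finitely many translates of [K]; following geodesics,
      every bounded set is covered by finitely many translates
      ([thickening_translates], [bounded_translates]).  The first of these
      lemmas contains the local compactness of the space.
    - For the same reason only finitely many elements of [G] move a given point
      by a bounded amount.  The centralizer of [H] acts on the set of fixed
      points of [H], which is nonempty and bounded, so it is finite
      ([finite_centralizer]).
    - Up to conjugacy, all finite subgroups lie in one finite set [S]: a finite
      group has a fixed point ([finite_group_fixed_point]), which can be moved
      into [K] ([finite_subgroups_up_to_conjugacy]).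

    The rest is group theory ([splits_virtually_Aut_to_Out]).  By the third fact,
    every outer class is represented by an automorphism mapping [H] into [S],
    which leaves finitely many possibilities for its restriction to [H].
    Therefore the automorphisms fixing [H] pointwise have an image of finite index
    in [Out G].  An inner automorphism among them is conjugation by an element of
    the finite centralizer of [H].  As [G] is residually finite, it has a normal
    subgroup [N] of finite index such that none of these conjugations except the
    identity is trivial on [G / N].  As [G] is finitely generated, [Aut G] induces
    only finitely many maps on [G / N], so requiring in addition that the
    automorphisms be trivial modulo [N] keeps the image of finite index.  On the
    group thus obtained, [rigid_aut H N], the map to [Out G] is injective, and
    its inverse is the virtual section.

    The same argument with finite quotients shows that [Aut G] is residually
    finite ([residually_finite_Aut]), and a virtual section transfers this to
    [Out G] ([residually_finite_splits_virtually]). *)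

Local Open Scope classical_set_scope.
Local Open Scope group_scope.

(** * Subgroups of finite index *)

Lemma is_subgroupP (G : groupType) (H : set G) :
  is_subgroup H <-> H 1 /\ forall x y, H x -> H y -> H (x / y).
Proof.
split=> -[H1 HF]; split; rewrite ?inE// in H1 *.
- by move=> x y Hx Hy; have := HF x y; rewrite !inE; apply.
- by move=> x y; rewrite !inE; exact: HF.
Qed.

Lemma subgroup1 (G : groupType) (H : set G) : is_subgroup H -> H 1.
Proof. by move=> /is_subgroupP[]. Qed.

Lemma subgroupF (G : groupType) (H : set G) x y :
  is_subgroup H -> H x -> H y -> H (x / y).
Proof. by move=> /is_subgroupP[_]; apply. Qed.

Lemma subgroupV (G : groupType) (H : set G) x :
  is_subgroup H -> H x -> H x^-1.
Proof.
by move=> sH Hx; rewrite -(mul1g x^-1); apply: subgroupF => //; apply: subgroup1.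
Qed.

Lemma subgroupM (G : groupType) (H : set G) x y :
  is_subgroup H -> H x -> H y -> H (x * y).
Proof.
by move=> sH Hx Hy; rewrite -(invgK y); apply: subgroupF => //; exact: subgroupV.
Qed.

Lemma subgroupI (G : groupType) (H K : set G) :
  is_subgroup H -> is_subgroup K -> is_subgroup (H `&` K).
Proof.
move=> sH sK; apply/is_subgroupP; split; first by split; exact: subgroup1.
by move=> x y [Hx Kx] [Hy Ky]; split; exact: subgroupF.
Qed.

Lemma lcoset_set_eqP (G : groupType) (H : set G) (x y : G) : is_subgroup H ->
  lcoset_set H x = lcoset_set H y <-> H (x^-1 * y).
Proof.
move=> sH; split=> [xy|Hxy].
  have [h Hh yE] : lcoset_set H x y.
    by rewrite xy; exists 1; [exact: subgroup1|rewrite mulg1].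
  by rewrite -yE mulgA mulVg mul1g.
apply/seteqP; split=> _ [h Hh <-].
- exists ((x^-1 * y)^-1 * h); first by apply: subgroupM => //; exact: subgroupV.
  by rewrite invgM invgK !mulgA mulgV mul1g.
- exists (x^-1 * y * h); first exact: subgroupM.
  by rewrite !mulgA mulgV mul1g.
Qed.

(** The way to bound an index throughout: an invariant with finitely many values
    that separates the left cosets. *)
Lemma finite_index_invariant (G : groupType) (H : set G) (T : Type)
    (E : set T) (f : G -> T) :
  is_subgroup H -> finite_set E -> (forall x, E (f x)) ->
  (forall x y, f x = f y -> H (x^-1 * y)) -> finite_index H.
Proof.
move=> sH finE Ef fH.
have [F FE] : {F : T -> set G & forall x, F (f x) = lcoset_set H x}.
  exists (fun t => [set z | exists x, f x = t /\ lcoset_set H x z]) => x.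
  apply/seteqP; split=> [z [y [/fH Hyx]]|z]; last by exists x.
  by move/lcoset_set_eqP: Hyx => ->.
apply: sub_finite_set (finite_image F finE) => _ [x _ <-].
by exists (f x).
Qed.

Lemma finite_indexI (G : groupType) (H K : set G) :
  is_subgroup H -> is_subgroup K -> finite_index H -> finite_index K ->
  finite_index (H `&` K).
Proof.
move=> sH sK fH fK.
apply: (@finite_index_invariant _ _ _ _
  (fun x => (lcoset_set H x, lcoset_set K x)) _ (finite_setX fH fK)).
- exact: subgroupI.
- by move=> x; split; exists x.
- by move=> x y [/lcoset_set_eqP Hxy /lcoset_set_eqP Kxy]; split; auto.
Qed.

Lemma finite_index_setT (G : groupType) : finite_index [set: G].
Proof.
apply: (@finite_index_invariant _ _ _ _ (fun=> tt) _ (finite_set1 tt)) => //.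
exact/is_subgroupP.
Qed.

(** A left coset of the intersection is determined by its coset of [K] and, once
    a base point is chosen there, by the coset of [D] containing the image under
    [f] of the displacement from the base point. *)
Lemma finite_index_preimage (G A : groupType) (K : set G) (D : set A)
    (f : G -> A) :
  is_subgroup K -> finite_index K -> is_subgroup D -> finite_index D ->
  {in K &, {morph f : x y / x * y}} ->
  is_subgroup (K `&` f @^-1` D) /\ finite_index (K `&` f @^-1` D).
Proof.
move=> sK fK sD fD fM.
have fM' x y : K x -> K y -> f (x * y) = f x * f y.
  by move=> Kx Ky; apply: fM; rewrite inE.
have K1 := subgroup1 sK.
have f1 : f 1 = 1 by apply: (mulgI (f 1)); rewrite mulg1 -fM' // mulg1.
have fV x : K x -> f x^-1 = (f x)^-1.
  move=> Kx; apply: (mulgI (f x)).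
  by rewrite -fM' ?mulgV //; exact: subgroupV.
have sKD : is_subgroup (K `&` f @^-1` D).
  apply/is_subgroupP; split; first by split=> //=; rewrite f1; exact: subgroup1.
  move=> x y [Kx /= Dx] [Ky /= Dy]; split; first exact: subgroupF.
  by rewrite /= fM' ?fV //; [exact: subgroupF|exact: subgroupV].
split=> //.
(* A base point in the left coset of [x], the same for the whole coset. *)
pose rep x := xget 1 (lcoset_set K x).
have repP x : K ((rep x)^-1 * x).
  apply/lcoset_set_eqP => //; rewrite /rep; case: xgetP => [_ -> [h Kh <-]|].
    by apply/lcoset_set_eqP => //; rewrite invgM -mulgA mulVg mulg1; exact: subgroupV.
  by move/(_ x)=> []; exists 1 => //; rewrite mulg1.
apply: (@finite_index_invariant _ _ _ _ (fun x => (lcoset_set K x,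
  lcoset_set D (f ((rep x)^-1 * x)))) sKD (finite_setX fK fD)).
  by move=> x; split=> /=; [exists x|exists (f ((rep x)^-1 * x))].
move=> x y [Kxy]; have -> : rep y = rep x by rewrite /rep Kxy.
have Ky : K ((rep x)^-1 * y) by have := repP y; rewrite /rep -Kxy.
have Kx := repP x.
rewrite lcoset_set_eqP// -fV// -fM'; [|exact: subgroupV|by []].
by rewrite invgM invgK -mulgA mulVKg; split=> //; exact/lcoset_set_eqP.
Qed.

(** * Residually finite groups *)

Lemma residually_finiteP (G : groupType) : residually_finite G <->
  forall x : G, x != 1 -> exists H, [/\ is_subgroup H, finite_index H & ~ H x].
Proof.
split=> [rf x x1|h].
  apply: contrapT => noH; move/eqP: x1; apply.
  suff : [set 1] x by [].
  rewrite -rf => H [sH fH]; apply: contrapT => nHx; apply: noH.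
  by exists H.
apply/seteqP; split=> [x Hx|_ -> H [sH _]]; last exact: subgroup1.
apply/eqP; apply: contrapT => /negP /h [H [sH fH]]; apply.
exact: Hx.
Qed.

Lemma finite_map_seq (U : eqType) (T : Type) (s : seq U) (A : set T) :
  finite_set A ->
  finite_set [set [seq f u | u <- s] | f in [set f | {in s, forall u, A (f u)}]].
Proof.
move=> finA; elim: s => [|u s IHs].
  by apply: sub_finite_set (finite_set1 [::]) => _ [f _ <-].
apply: sub_finite_set (finite_image2 cons finA IHs) => _ [f Af <-] /=.
exists (f u); first by apply: Af; rewrite mem_head.
exists [seq f v | v <- s] => //; exists f => // v sv.
by apply: Af; rewrite inE sv orbT.
Qed.

(** [G] acts on the finitely many left cosets of [H]; the core of [H] is the
    kernel of this action, hence has finite index. *)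
Lemma normal_core (G : groupType) (H : set G) :
  is_subgroup H -> finite_index H ->
  exists N, [/\ is_normal N, finite_index N & N `<=` H].
Proof.
move=> sH fH; pose N := [set n : G | forall g, H (n ^ g)].
have sN : is_subgroup N.
  apply/is_subgroupP; split=> [g|x y Nx Ny g].
    by rewrite conj1g; exact: subgroup1.
  by rewrite conjMg conjVg; exact: subgroupF.
exists N; split; last by move=> n /(_ 1); rewrite conjg1.
  by split=> // x y Nx g; rewrite -conjgM.
have /finite_seqP [s sE] := fH.
pose rep (c : set G) := xget 1 [set g | lcoset_set H g = c].
have repP g : lcoset_set H (rep (lcoset_set H g)) = lcoset_set H g.
  by rewrite /rep; case: xgetP => [//|/(_ g)[]].
apply: (@finite_index_invariant _ _ _ _
  (fun x => [seq lcoset_set H (x * rep c) | c <- s]) sN (finite_map_seq s fH)).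
  by move=> x; exists (fun c => lcoset_set H (x * rep c)) => // c _; eexists.
move=> x y xy g.
set r := rep (lcoset_set H g); have Hrg : H (r^-1 * g).
  by apply/lcoset_set_eqP => //; exact: repP.
have : lcoset_set H (x * r) = lcoset_set H (y * r).
  have /eq_in_map : [seq lcoset_set H (x * rep c) | c <- s] =
    [seq lcoset_set H (y * rep c) | c <- s] by [].
  by apply; have : range (lcoset_set H) (lcoset_set H g);
    [exists g | rewrite sE].
move=> /lcoset_set_eqP-/(_ sH); rewrite invgM => Hxy.
have -> : (x^-1 * y) ^ g = (r^-1 * g)^-1 * (r^-1 * x^-1 * (y * r)) * (r^-1 * g).
  by rewrite conjgE invgM invgK !mulgA !mulgK.
by apply: subgroupM => //; apply: subgroupM => //; exact: subgroupV.
Qed.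

Lemma residually_finite_avoid (G : groupType) (s : seq G) :
  residually_finite G -> 1 \notin s ->
  exists N, [/\ is_normal N, finite_index N & {in s, forall x, ~ N x}].
Proof.
move=> /residually_finiteP rf; elim: s => [_|x s IHs].
  exists [set: G]; split=> //; last exact: finite_index_setT.
  by split=> //; exact/is_subgroupP.
rewrite inE negb_or eq_sym => /andP[/rf [H [sH fH Hx]] /IHs [N [nN fN Ns]]].
have [M [nM fM MH]] := normal_core sH fH.
exists (M `&` N); split.
- split; first by apply: subgroupI; [case: nM|case: nN].
  by case: nM nN => [_ MJ] [_ NJ] y z [My Ny]; split; [exact: MJ|exact: NJ].
- by apply: finite_indexI => //; [case: nM|case: nN].
- move=> y; rewrite inE => /predU1P[->{y} [/MH]//|/Ns Ny []//].
Qed.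

(** * Automorphisms of finitely generated groups *)

Definition generates (G : groupType) (T : set G) : Prop :=
  forall P : set G, is_subgroup P -> T `<=` P -> P = setT.

Lemma aut1 (G : groupType) (a : Aut G) : a 1 = 1.
Proof. by apply: (mulgI (a 1)); rewrite -autM !mulg1. Qed.

Lemma autV (G : groupType) (a : Aut G) (x : G) : a x^-1 = (a x)^-1.
Proof. by apply: (mulgI (a x)); rewrite -autM !mulgV aut1. Qed.

(** Equivalently, [pi \o a = pi] for the projection [pi] from [G] to [G / N]. *)
Definition aut_trivial_mod (G : groupType) (N : set G) : set (Aut G) :=
  [set a | forall g, N (g^-1 * a g)].

Lemma aut_trivial_mod_subgroup (G : groupType) (N : set G) :
  is_subgroup N -> is_subgroup (aut_trivial_mod N).
Proof.
move=> sN; apply/is_subgroupP; split=> [g|a b Na Nb g].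
  by rewrite mulVg; exact: subgroup1.
change (N (g^-1 * a (aut_finv b g))).
rewrite -[in X in X * _](autVK b g); set y := aut_finv b g.
have -> : (b y)^-1 * a y = (y^-1 * b y)^-1 * (y^-1 * a y).
  by rewrite invgM invgK mulgA mulgK.
by apply: subgroupM => //; exact: subgroupV.
Qed.

(** The two automorphisms induce homomorphisms to [G / N]; their equalizer is a
    subgroup. *)
Lemma eq_mod_generators (G : groupType) (T N : set G) (a b : Aut G) :
  generates T -> is_normal N -> (forall t, T t -> N ((a t)^-1 * b t)) ->
  forall g, N ((a g)^-1 * b g).
Proof.
move=> genT [sN NJ] abT; suff : [set g | N ((a g)^-1 * b g)] = setT.
  by move=> PT g; have : [set: G] g by []; rewrite -PT.
apply: genT => //; apply/is_subgroupP; split=> [|x y /= Nx Ny].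
  by rewrite /= !aut1 mulVg; exact: subgroup1.
have -> : (a (x / y))^-1 * b (x / y) =
    ((a x)^-1 * b x / ((a y)^-1 * b y)) ^ (a y)^-1.
  by rewrite conjgE !(autM, autV, invgM, invgK) !mulgA mulgK.
by apply: NJ; exact: subgroupF.
Qed.

(** There are only finitely many maps from the generators to [G / N]. *)
Lemma aut_trivial_mod_finite_index (G : groupType) (T N : set G) :
  finite_set T -> generates T -> is_normal N -> finite_index N ->
  finite_index (aut_trivial_mod N).
Proof.
move=> /finite_seqP[s TE] genT nN fN; have [sN _] := nN.
(* The inverse makes the invariant constant on left, not right, cosets. *)
apply: (@finite_index_invariant _ _ _ _
  (fun a : Aut G => [seq lcoset_set N ((a^-1 : Aut G) t) | t <- s])
  (aut_trivial_mod_subgroup sN) (finite_map_seq s fN)).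
  move=> a; exists (fun t => lcoset_set N ((a^-1 : Aut G) t)) => //= t _.
  by exists ((a^-1 : Aut G) t).
move=> a b /eq_in_map ab g.
suff /(_ (b g)) : forall x, N (((b^-1 : Aut G) x)^-1 * (a^-1 : Aut G) x).
  by rewrite /= (autK b).
apply: eq_mod_generators genT nN _ => t; rewrite TE => /= st.
by apply/lcoset_set_eqP => //; rewrite ab.
Qed.

(** The argument of Baumslag: if [a] moves [g], some finite quotient of [G]
    separates [g] from [a g], so that [a] acts nontrivially on it. *)
Lemma residually_finite_Aut (G : groupType) (T : set G) :
  finite_set T -> generates T -> residually_finite G ->
  residually_finite (Aut G).
Proof.
move=> finT genT rf; apply/residually_finiteP => a a1.
have [g ga] : exists g, a g <> g.
  apply: contrapT => noa; move/eqP: a1; apply; apply: autP => g /=.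
  by apply: contrapT => ag; apply: noa; exists g.
have [|N [nN fN Nga]] := @residually_finite_avoid G [:: g^-1 * a g] rf.
  rewrite inE eq_sym; apply/eqP => ga1; apply: ga.
  by apply: (mulgI g^-1); rewrite ga1 mulVg.
exists (aut_trivial_mod N); split.
- by apply: aut_trivial_mod_subgroup; case: nN.
- exact: aut_trivial_mod_finite_index finT genT nN fN.
- by move=> /(_ g); apply: Nga; rewrite inE.
Qed.

(** * Virtual splitting *)

Lemma multiplicative1 (A B : groupType) (f : {multiplicative A -> B}) : f 1 = 1.
Proof. by apply: (mulgI (f 1)); rewrite -gmulfM !mulg1. Qed.

Lemma multiplicativeV (A B : groupType) (f : {multiplicative A -> B}) (x : A) :
  f x^-1 = (f x)^-1.
Proof. by apply: (mulgI (f x)); rewrite -gmulfM !mulgV multiplicative1. Qed.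

(** An element of the domain [K] of the section is separated from [1] by pulling
    back a finite index subgroup of [A] along the section, an element outside
    [K] by [K] itself. *)
Lemma residually_finite_splits_virtually (A B : groupType)
    (f : {multiplicative A -> B}) :
  splits_virtually f -> residually_finite A -> residually_finite B.
Proof.
move=> [K [sK fK [g [gM gK]]]] /residually_finiteP rfA.
apply/residually_finiteP => b b1; have [Kb|nKb] := pselect (K b); last first.
  by exists K.
have [D [sD fD Dgb]] : exists D, [/\ is_subgroup D, finite_index D & ~ D (g b)].
  apply: rfA; apply: contra_neq b1 => gb1.
  by rewrite -[b]gK ?inE// gb1 multiplicative1.
have [sE fE] := finite_index_preimage sK fK sD fD gM.
by exists (K `&` g @^-1` D); split=> // -[].
Qed.

(** For suitable [H] and [N], a subgroup on which [Aut G -> Out G] is injective and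
    whose image has finite index. *)
Definition rigid_aut (G : groupType) (H N : set G) : set (Aut G) :=
  [set a : Aut G | forall h, H h -> a h = h] `&` aut_trivial_mod N.

Lemma rigid_aut_subgroup (G : groupType) (H N : set G) :
  is_subgroup N -> is_subgroup (rigid_aut H N).
Proof.
move=> sN; apply: subgroupI; last exact: aut_trivial_mod_subgroup.
apply/is_subgroupP; split=> // a b Ha Hb h Hh.
change (a (aut_finv b h) = h).
by rewrite -[in aut_finv b h](Hb h Hh) autK Ha.
Qed.

Lemma Aut_to_Out_eqP (G : groupType) (a b : Aut G) :
  Aut_to_Out G a = Aut_to_Out G b <-> Inn (a^-1 * b).
Proof. exact: quotient_mapP. Qed.

Lemma subgroup_image (A B : groupType) (f : {multiplicative A -> B})
    (H : set A) : is_subgroup H -> is_subgroup (f @` H).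
Proof.
move=> sH; apply/is_subgroupP; split.
  by exists 1; [exact: subgroup1|exact: multiplicative1].
move=> _ _ [x Hx <-] [y Hy <-]; exists (x / y); first exact: subgroupF.
by rewrite gmulfM multiplicativeV.
Qed.

Definition inner_aut (G : groupType) (g : G) : Aut G :=
  @MkAut G (conjg^~ g) (conjg^~ g^-1) (fun x y => conjMg x y g)
    (conjgK g) (conjgKV g).

Lemma Aut_to_Out_inner (G : groupType) (g : G) (a : Aut G) :
  Aut_to_Out G (inner_aut g * a) = Aut_to_Out G a.
Proof.
rewrite gmulfM; suff -> : Aut_to_Out G (inner_aut g) = 1 by rewrite mul1g.
rewrite -(multiplicative1 (Aut_to_Out G)); apply/esym/Aut_to_Out_eqP.
exists g^-1 => x.
by rewrite invgK -mulgA.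
Qed.

(** Every outer class has a representative [a] with [a H `<=` S]; if two of them
    agree on [H] and their inverses agree modulo [N], they differ by an element of
    [rigid_aut H N]. *)
Lemma rigid_aut_finite_index_Out (G : groupType) (T H S N : set G) :
  finite_set T -> generates T -> finite_set H -> finite_set S ->
  (forall a : Aut G, exists g : G, forall h, H h -> S ((a h) ^ g)) ->
  is_normal N -> finite_index N ->
  finite_index (Aut_to_Out G @` rigid_aut H N).
Proof.
move=> /finite_seqP[sT TE] genT /finite_seqP[sH HE] finS conjS nN fN.
have [sN _] := nN.
have /choice [r rP] : forall o : Out G, exists a : Aut G,
    Aut_to_Out G a = o /\ forall h, H h -> S (a h).
  move=> o; have [a <-] := Aut_to_Out_surj o; have [g gS] := conjS a.
  by exists (inner_aut g * a); split; [exact: Aut_to_Out_inner|].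
have sR := subgroup_image (Aut_to_Out G) (rigid_aut_subgroup H sN).
apply: (@finite_index_invariant _ _ _ _
  (fun o => ([seq r o h | h <- sH],
    [seq lcoset_set N (((r o)^-1 : Aut G) t) | t <- sT])) sR
  (finite_setX (finite_map_seq sH finS) (finite_map_seq sT fN))).
  move=> o; split=> /=.
    by exists (r o) => //= h sh; apply: (rP o).2; rewrite HE.
  exists (fun t => lcoset_set N (((r o)^-1 : Aut G) t)) => //= t _.
  by exists (((r o)^-1 : Aut G) t).
move=> o o' [/eq_in_map oH /eq_in_map oN].
exists ((r o)^-1 * r o'); last first.
  by rewrite gmulfM multiplicativeV (rP o).1 (rP o').1.
split=> [h Hh|g]; rewrite /=.
  by rewrite -oH ?autK//; rewrite HE in Hh.
suff /(_ (r o' g)) : forall x,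
    N ((((r o')^-1 : Aut G) x)^-1 * ((r o)^-1 : Aut G) x).
  by rewrite /= (autK (r o')).
apply: eq_mod_generators genT nN _ => t; rewrite TE => /= st.
by apply/lcoset_set_eqP => //; rewrite oN.
Qed.

(** An inner automorphism fixing [H] pointwise is conjugation by one of the
    finitely many elements of the centralizer of [H]; when nontrivial it moves
    some [g], and [N] can be chosen to separate [g] from its image. *)
Lemma rigid_aut_meets_Inn_trivially (G : groupType) (H : set G) :
  residually_finite G ->
  finite_set [set c | forall h, H h -> h ^ c = h] ->
  exists N, [/\ is_normal N, finite_index N &
    forall a, rigid_aut H N a -> Inn a -> a = 1].
Proof.
move=> rf /finite_seqP [s sE].
(* The default value is taken at central elements only; their defect is [1]. *)
pose moved (c : G) : G := xget 1 [set g | g ^ c <> g].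
pose defect (c : G) : G := (moved c)^-1 * (moved c) ^ c.
have [|N [nN fN Nd]] := @residually_finite_avoid G
    [seq x <- [seq defect c | c <- s] | x != 1] rf.
  by rewrite mem_filter eqxx.
exists N; split=> // a [Ha Na] [k ak].
have {}ak x : a x = x ^ k^-1 by rewrite ak conjgE invgK mulgA.
apply: autP => /= g; apply: contrapT => ag.
have kC : k^-1 \in s.
  by have : [set` s] k^-1; [rewrite -sE => h Hh; rewrite -ak Ha|].
have mk : (moved k^-1) ^ k^-1 <> moved k^-1.
  by rewrite /moved; case: xgetP => [y _ //|/(_ g)[]]; rewrite /= -ak.
apply: (Nd (defect k^-1)); last by rewrite /defect -ak; exact: Na.
rewrite mem_filter map_f// andbT; apply/eqP => d1; apply: mk.
by apply: (mulgI (moved k^-1)^-1); rewrite -/(defect _) d1 mulVg.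
Qed.

(** The section inverts the projection on [rigid_aut H N]; being unique, it is a
    homomorphism.  The hypothesis on [S] says that, up to conjugacy, [Aut G]
    moves [H] through finitely many subgroups. *)
Theorem splits_virtually_Aut_to_Out (G : groupType) (T H S : set G) :
  residually_finite G -> finite_set T -> generates T ->
  finite_set H -> finite_set S ->
  (forall a : Aut G, exists g : G, forall h, H h -> S ((a h) ^ g)) ->
  finite_set [set c : G | forall h, H h -> h ^ c = h] ->
  splits_virtually (Aut_to_Out G).
Proof.
move=> rf finT genT finH finS conjS finC.
have [N [nN fN NInn]] := rigid_aut_meets_Inn_trivially rf finC.
have sN : is_subgroup N by case: nN.
have sR := rigid_aut_subgroup H sN.
exists (Aut_to_Out G @` rigid_aut H N); split.
- exact: subgroup_image.
- exact: (@rigid_aut_finite_index_Out _ T H S N).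
have inj a b : rigid_aut H N a -> rigid_aut H N b ->
    Aut_to_Out G a = Aut_to_Out G b -> a = b.
  move=> Ra Rb /Aut_to_Out_eqP ab; apply: (mulgI a^-1); rewrite mulVg.
  apply/esym; apply: NInn; last exact: ab.
  by apply: subgroupM => //; exact: subgroupV.
pose sec o := xget 1 [set a | rigid_aut H N a /\ Aut_to_Out G a = o].
have secP a : rigid_aut H N a -> sec (Aut_to_Out G a) = a.
  rewrite /sec => Ra; case: xgetP => [b _ [Rb ba]|/(_ a)[] //].
  exact: inj.
exists sec; split=> [u v|u]; rewrite !inE.
  move=> [a Ra <-] [b Rb <-]; rewrite -gmulfM !secP//; exact: subgroupM.
by move=> [a Ra <-]; rewrite secP.
Qed.

Local Close Scope group_scope.
Local Open Scope ring_scope.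

(** * Fixed points of finite groups acting on CAT(0) spaces *)

Definition plane_point (R : realType) (a b : R) : 'rV[R]_2 :=
  \row_(j < 2) (if j == ord0 then a else b).

Lemma edistE (R : realType) (a b : 'rV[R]_2) :
  Defs.edist a b =
    Num.sqrt ((a 0 ord0 - b 0 ord0) ^+ 2 + (a 0 ord_max - b 0 ord_max) ^+ 2).
Proof.
rewrite /Defs.edist !big_ord_recl big_ord0 addr0.
by have -> : lift ord0 ord0 = ord_max :> 'I_2 by exact: val_inj.
Qed.

Lemma edist_plane_point (R : realType) (a b c d : R) :
  Defs.edist (plane_point a b) (plane_point c d) =
    Num.sqrt ((a - c) ^+ 2 + (b - d) ^+ 2).
Proof. by rewrite edistE !mxE. Qed.

Lemma edist_eq (R : realType) (a b c d r : R) : 0 <= r ->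
  (a - c) ^+ 2 + (b - d) ^+ 2 = r ^+ 2 ->
  Defs.edist (plane_point a b) (plane_point c d) = r.
Proof.
by move=> r0; rewrite edist_plane_point => ->; rewrite sqrtr_sqr ger0_norm.
Qed.

Lemma edist_sym (R : realType) (a b : 'rV[R]_2) : Defs.edist a b = Defs.edist b a.
Proof.
by rewrite /Defs.edist; congr Num.sqrt; apply: eq_bigr => i _; rewrite -sqrrN opprB.
Qed.

Lemma ord3_ind (P : 'I_3 -> Prop) :
  P ord0 -> P (Ordinal (isT : (1 < 3)%N)) -> P ord_max -> forall i, P i.
Proof.
by move=> P0 P1 P2 [[|[|[|//]]] p]; [move: P0|move: P1|move: P2];
  congr P; exact: val_inj.
Qed.

(** The apex of the comparison triangle is given by the law of cosines. *)
Lemma ex_comparison_triangle (R : realType) (X : metricType R) (v : 'I_3 -> X) :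
  exists w, comparison_triangle v w.
Proof.
pose i0 : 'I_3 := ord0; pose i1 : 'I_3 := Ordinal (isT : (1 < 3)%N).
pose i2 : 'I_3 := ord_max.
set a := mdist (v i0) (v i1); set b := mdist (v i0) (v i2).
set c := mdist (v i1) (v i2).
have a0 : 0 <= a by exact: mdist_ge0.
have b0 : 0 <= b by exact: mdist_ge0.
have c0 : 0 <= c by exact: mdist_ge0.
have abc : a <= b + c by rewrite [c]metric_sym; exact: metric_triangle.
have bac : b <= a + c by exact: metric_triangle.
have cab : c <= a + b by rewrite [a]metric_sym; exact: metric_triangle.
suff [w [w01 w02 w12]] : exists w : 'I_3 -> 'rV[R]_2,
    [/\ Defs.edist (w i0) (w i1) = a, Defs.edist (w i0) (w i2) = b &
        Defs.edist (w i1) (w i2) = c].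
  have wxx i : Defs.edist (w i) (w i) = mdist (v i) (v i).
    rewrite mdistxx /Defs.edist big1 ?sqrtr0// => j _.
    by rewrite subrr expr0n.
  have wsym i j : Defs.edist (w i) (w j) = mdist (v i) (v j) ->
      Defs.edist (w j) (w i) = mdist (v j) (v i).
    by rewrite edist_sym metric_sym.
  by exists w; apply: ord3_ind; apply: ord3_ind => //; apply: wsym.
pose tri (w0 w1 w2 : 'rV[R]_2) : 'I_3 -> 'rV[R]_2 :=
  fun i => nth 0 [:: w0; w1; w2] i.
have [aE|aN0] := eqVneq a 0.
  have bc : b = c by apply/eqP; rewrite eq_le; apply/andP; split; lra.
  exists (tri (plane_point 0 0) (plane_point 0 0) (plane_point b 0)).
  by split; apply: edist_eq => //; rewrite ?aE -?bc; ring.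
pose x := (a ^+ 2 + b ^+ 2 - c ^+ 2) / (2 * a).
have xE : x * (2 * a) = a ^+ 2 + b ^+ 2 - c ^+ 2.
  by rewrite /x mulfVK// mulf_neq0// pnatr_eq0.
have x2b2 : 0 <= b ^+ 2 - x ^+ 2.
  have : 0 <= (b ^+ 2 - x ^+ 2) * (2 * a) ^+ 2.
    have -> : (b ^+ 2 - x ^+ 2) * (2 * a) ^+ 2 =
        (a + b + c) * (a + b - c) * ((b + c - a) * (a + c - b)).
      have -> : (b ^+ 2 - x ^+ 2) * (2 * a) ^+ 2 =
        b ^+ 2 * (2 * a) ^+ 2 - (x * (2 * a)) ^+ 2 by ring.
      by rewrite xE; ring.
    by apply: mulr_ge0; apply: mulr_ge0; lra.
  by rewrite pmulr_lge0// exprn_gt0// mulr_gt0// lt_neqAle eq_sym aN0.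
exists (tri (plane_point 0 0) (plane_point a 0)
  (plane_point x (Num.sqrt (b ^+ 2 - x ^+ 2)))).
split; apply: edist_eq => //; first by ring.
- rewrite sub0r !sqrrN sub0r sqrrN sqr_sqrtr//; ring.
- rewrite sub0r sqrrN sqr_sqrtr//; lra.
Qed.

Lemma edist_midpoint (R : realType) (a b p : 'rV[R]_2) :
  Defs.edist (segment_point a b 2^-1) p ^+ 2 =
    (Defs.edist p a ^+ 2 + Defs.edist p b ^+ 2) / 2 - Defs.edist a b ^+ 2 / 4.
Proof.
rewrite !edistE !sqr_sqrtr ?addr_ge0 ?sqr_ge0// /segment_point !mxE.
by field.
Qed.

(** The inequality of Bruhat and Tits: in the comparison triangle it is the
    parallelogram law. *)
Lemma CN_inequality (R : realType) (X : metricType R) : CAT0_space X ->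
  forall x y : X, exists m, forall p,
    mdist m p ^+ 2 <= (mdist p x ^+ 2 + mdist p y ^+ 2) / 2 - mdist x y ^+ 2 / 4.
Proof.
move=> [geoX cat] x y; have [->|xy] := eqVneq x y.
  by exists y => p; rewrite mdistxx metric_sym; lra.
have [c0 c0P] := geoX x y.
exists (c0 (mdist x y / 2)) => p.
have [c1 c1P] := geoX y p; have [c2 c2P] := geoX p x.
pose v (i : 'I_3) := nth x [:: x; y; p] i.
pose c (i : 'I_3) := nth c0 [:: c0; c1; c2] i.
have vc : geodesic_triangle v c by move=> [[|[|[|//]]] i].
have [w vw] := ex_comparison_triangle v.
have d0 : 0 < mdist x y by rewrite mdist_gt0.
pose i0 : 'I_3 := ord0; pose i2 : 'I_3 := ord_max.
have s_in : mdist x y / 2 \in `[0, mdist x y].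
  by rewrite in_itv /=; apply/andP; split; lra.
have t_in : 0 \in `[0, mdist p x] by rewrite in_itv /= lexx mdist_ge0.
have := cat v c w vc vw i0 i2 _ _ s_in t_in.
have -> : c i0 = c0 by [].
have -> : c i2 0 = p by have [] := c2P.
rewrite /comparison_point mul0r.
have -> : v (ordS i0) = y by [].
have -> : v i0 = x by [].
have -> : mdist x y / 2 / mdist x y = 2^-1 by field; rewrite gt_eqF.
have -> : segment_point (w i2) (w (ordS i2)) 0 = w i2.
  by rewrite /segment_point subr0 scale1r scale0r addr0.
move=> le; have := edist_midpoint (w i0) (w (ordS i0)) (w i2).
rewrite !vw /= => <-.
by rewrite ler_pXn2r ?nnegrE ?mdist_ge0// sqrtr_ge0.
Qed.

Lemma act_invK (R : realType) (G : groupType) (X : metricType R)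
    (act : G -> X -> X) (g : G) (x : X) :
  isometric_action act -> act g^-1%g (act g x) = x.
Proof. by case=> a1 aM _; rewrite -aM mulVg a1. Qed.

Lemma act_Kinv (R : realType) (G : groupType) (X : metricType R)
    (act : G -> X -> X) (g : G) (x : X) :
  isometric_action act -> act g (act g^-1%g x) = x.
Proof. by case=> a1 aM _; rewrite -aM mulgV a1. Qed.

Lemma mdist_act_inv (R : realType) (G : groupType) (X : metricType R)
    (act : G -> X -> X) (g : G) (x y : X) : isometric_action act ->
  mdist (act g x) y = mdist x (act g^-1%g y).
Proof.
by move=> iso; rewrite -{1}(act_Kinv g y iso) act_isometry.
Qed.

(** The fixed point is the minimum of the sum of the squared distances to an
    orbit. By the inequality of Bruhat and Tits the nearly minimal points form a
    Cauchy filter, and elements of [H] move them little. *)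
Lemma finite_group_fixed_point (R : realType) (G : groupType)
    (X : completeMetricType R) (act : G -> X -> X) (H : set G) :
  CAT0_space X -> isometric_action act -> is_subgroup H -> finite_set H ->
  fixed_points act H !=set0.
Proof.
move=> cat iso sH /finite_seqP[s0 HE].
pose s := undup s0.
have sHE h : (h \in s) = `[< H h >].
  by rewrite mem_undup HE; apply/idP/asboolP.
have s1 : 1 <= (size s)%:R :> R.
  rewrite ler1n; have : 1%g \in s by rewrite sHE; apply/asboolP; exact: subgroup1.
  by case: (s).
pose f (x : X) := \sum_(h <- s) mdist x (act h point) ^+ 2.
have f_ge0 x : 0 <= f x by apply: sumr_ge0 => h _; exact: sqr_ge0.
have fH g x : H g -> f (act g x) = f x.
  move=> Hg; rewrite /f; have sP : perm_eq s [seq (g * h)%g | h <- s].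
    apply: uniq_perm; first exact: undup_uniq.
      by rewrite map_inj_uniq ?undup_uniq//; exact: mulgI.
    move=> h; rewrite sHE; apply/asboolP/mapP => [Hh|[k]].
      exists (g^-1 * h)%g; last by rewrite mulVKg.
      by rewrite sHE; apply/asboolP; apply: subgroupM => //; exact: subgroupV.
    by rewrite sHE => /asboolP Hk ->; exact: subgroupM.
  rewrite (perm_big _ sP) big_map; apply: eq_bigr => h _.
  by rewrite (act_mul iso) (act_isometry iso).
have f_inf : has_inf (range f).
  by split; [exists (f point), point|exists 0 => _ [x _ <-]].
set I := inf (range f).
have If x : I <= f x by apply: ge_inf; [case: f_inf|exists x].
have key x y : mdist x y ^+ 2 <= 2 * (f x + f y) - 4 * I.
  have [m mP] := CN_inequality cat x y.
  have : f m <= (f x + f y) / 2 - mdist x y ^+ 2 / 4 * (size s)%:R.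
    rewrite /f; elim: (s) => [|h t IHt] /=; first by rewrite !big_nil mulr0n; lra.
    rewrite !big_cons -[(size t).+1%:R]natr1; have := mP (act h point).
    rewrite (metric_sym _ x) (metric_sym (act h point) y); lra.
  have := If m; have : mdist x y ^+ 2 / 4 <= mdist x y ^+ 2 / 4 * (size s)%:R.
    by rewrite ler_peMr// divr_ge0// sqr_ge0.
  lra.
pose F := filter_from [set e : R | 0 < e] (fun e => [set x | f x < I + e]).
have FF : ProperFilter F.
  apply: filter_from_proper.
    apply: filter_from_filter; first by exists 1 => /=.
    move=> d e /= d0 e0; exists (Num.min d e); first by rewrite /= lt_min d0.
    by move=> x /=; rewrite -ltrBlDl lt_min !ltrBlDl => /andP[].
  move=> e /= e0; have [_ [x _ <-] fx] := inf_adherent e0 f_inf.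
  by exists x.
have Fclose (e : R) : 0 < e -> exists2 A, F A & forall x y, A x -> A y ->
    mdist x y < e.
  move=> e0; exists [set x | f x < I + e ^+ 2 / 4].
    by exists (e ^+ 2 / 4) => //=; rewrite divr_gt0// exprn_gt0.
  move=> x y /= fx fy; rewrite -(ltr_pXn2r (n := 2))// ?nnegrE ?mdist_ge0 ?ltW//.
  apply: le_lt_trans (key x y) _; lra.
have /cauchy_cvg : cauchy F.
  apply/cauchy_ballP => e /Fclose[A FA Ae].
  exists (A, A) => //= -[x y] /= [Ax Ay].
  by rewrite ballEmdist/=; exact: Ae.
move=> Fcvg; pose z : X := lim F; exists z => h Hh.
apply: mdist_positivity; apply/eqP; rewrite eq_le mdist_ge0 andbT.
apply/ler_addgt0Pl => e e0; rewrite addr0.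
have e3 : 0 < e / 3 by rewrite divr_gt0.
have [A [d d0 dA] Ae] := Fclose _ e3.
have [x [zx /= fx]] : exists x, mdist z x < e / 3 /\ f x < I + d.
  suff /filter_ex[x [zx fx]] : F ([set x | mdist z x < e / 3] `&` [set x | f x < I + d]).
    by exists x.
  apply: filterI; last by exists d.
  by have := Fcvg _ (nbhsx_ballx z _ e3); rewrite ballEmdist.
have hx : mdist (act h x) x < e / 3 by apply: Ae; apply: dA; rewrite //= fH.
have := metric_triangle (act h z) (act h x) z.
have := metric_triangle (act h x) x z.
rewrite (act_isometry iso) (metric_sym x z); lra.
Qed.

(** * Proper discontinuity on bounded sets *)

(** A Lebesgue number. *)
Lemma compact_thickening (R : realType) (X : metricType R) (K U : set X) :
  compact K -> open U -> K `<=` U ->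
  exists2 e : R, 0 < e & forall x y, K x -> mdist x y < e -> U y.
Proof.
move=> /compact_near_coveringP Kcov oU KU.
have : \forall e \near 0^'+, K `<=` [set x | forall y, mdist x y < e -> U y].
  apply: Kcov => x Kx.
  have /nbhs_ballP[e /= e0 xeU] : nbhs x U by apply: open_nbhs_nbhs; split; [|exact: KU].
  have e2 : 0 < e / 2 by rewrite divr_gt0.
  exists (ball x (e / 2), [set d | d < e / 2]) => /=.
    by split; [exact: nbhsx_ballx|exact: nbhs_right_lt].
  move=> [x' d] /= [xx' de] y x'y; apply: xeU.
  rewrite [e]splitr; apply: ball_triangle xx' _.
  by rewrite ballEmdist /=; exact: lt_trans de.
move=> H; have /filter_ex[e [e0 eK]] :
  (0 : R)^'+ (`]0, +oo[ `&` [set e | K `<=` [set x | forall y, mdist x y < e -> U y]]).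
  apply: filterI => //; near=> e; rewrite /= in_itv /= andbT; near: e.
  exact: nbhs_right_gt.
exists e; first by move: e0; rewrite /= in_itv /= andbT.
by move=> x y /eK; apply.
Unshelve. all: by end_near. Qed.

(** A sequence whose distance to [K] tends to zero accumulates only on [K]. *)
Lemma compact_setU_range (R : realType) (X : completeMetricType R) (K : set X)
    (u : nat -> X) :
  compact K ->
  (forall n, exists2 z, K z & mdist z (u n) < n.+1%:R^-1) ->
  compact (K `|` range u).
Proof.
move=> cK Ku; rewrite compact_cover => J D f fo.
rewrite subUset => -[Kf uf].
have := cK; rewrite compact_cover => /(_ J D f fo Kf)[D1 D1D KD1].
have oU : open (cover [set` D1] f).
  by apply: bigcup_open => i /D1D; rewrite inE; exact: fo.
have [e e0 eU] := compact_thickening cK oU KD1.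
have [n ne] : exists n, n.+1%:R^-1 < e.
  have /filter_ex[n ne] := near_infty_natSinv_lt (PosNum e0).
  by exists n.
have cun : compact (u @` `I_n) by apply/finite_compact/finite_image/finite_II.
have ufn : u @` `I_n `<=` cover D f by move=> _ [k _ <-]; apply: uf; exists k.
move: cun; rewrite compact_cover => /(_ J D f fo ufn)[D2 D2D uD2].
exists (D1 `|` D2)%fset.
  by move=> i; rewrite in_fsetU => /orP[/D1D|/D2D].
move=> x [/KD1[i iD1 fx]|[k _ <-]].
  by exists i => //=; rewrite in_fsetU iD1.
have [kn|nk] := ltnP k n.
  have [|i iD2 fx] := uD2 (u k); first by exists k.
  by exists i => //=; rewrite in_fsetU iD2 orbT.
have [z Kz zk] := Ku k; have [|i iD1 fx] := eU z (u k) Kz.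
  apply: lt_trans ne; apply: lt_le_trans zk _.
  by rewrite lef_pV2 ?posrE ?ltr0n// ler_nat.
by exists i => //=; rewrite in_fsetU iD1.
Qed.

Definition translates (G : groupType) (X : Type) (act : G -> X -> X)
    (E : set G) (K : set X) : set X := \bigcup_(g in E) (act g @` K).

Definition returns (G : groupType) (X : Type) (act : G -> X -> X)
    (K : set X) : set G := [set g | (act g @` K) `&` K !=set0].

(** Otherwise there are points [y n] approaching [K] and lying in pairwise
    distinct translates of [K]; adding them to [K] gives a compact set with
    infinitely many returns. *)
Lemma thickening_translates (R : realType) (G : groupType)
    (X : completeMetricType R) (act : G -> X -> X) (K : set X) :
  properly_discontinuous act -> compact K ->
  translates act setT K = setT ->
  exists e : R, exists E : set G, [/\ 0 < e, finite_set E &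
    forall y z, K z -> mdist z y <= e -> translates act E K y].
Proof.
move=> pd cK GK; apply: contrapT => noE.
have next (s : seq G) : exists yg : X * G,
    [/\ exists2 z, K z & mdist z yg.1 < (size s).+1%:R^-1,
        ~ translates act [set` s] K yg.1 & (act yg.2 @` K) yg.1].
  apply: contrapT => nos; apply: noE.
  exists ((size s).+1%:R^-1 / 2), [set` s]; split.
  - by rewrite divr_gt0// invr_gt0 ltr0n.
  - by apply/finite_seqP; exists s.
  move=> y z Kz zy; apply: contrapT => nsy; apply: nos.
  have : translates act setT K y by rewrite GK.
  move=> [g _ gy]; exists (y, g); split=> //; exists z => //.
  apply: le_lt_trans zy _.
  by rewrite ltr_pdivrMr// ltr_pMr ?invr_gt0 ?ltr0n// ltr1n.
have /choice[yg ygP] := next.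
pose s := fix s n := if n is m.+1 then (yg (s m)).2 :: s m else [::].
have size_s n : size (s n) = n by elim: n => //= n ->.
pose y n := (yg (s n)).1.
have yK n : exists2 z, K z & mdist z (y n) < n.+1%:R^-1.
  by have [] := ygP (s n); rewrite size_s.
have /finite_seqP[t tE] := pd _ (compact_setU_range cK yK).
have sP n : uniq (s n) && all [in t] (s n).
  elim: n => //= n /andP[-> ->]; have [_ ny [k Kk gk]] := ygP (s n).
  rewrite !andbT; apply/andP; split.
    by apply/negP => gs; apply: ny; exists (yg (s n)).2 => //; exists k.
  have : [set` t] (yg (s n)).2; last by [].
  rewrite -tE /=; exists (y n); split; last by right; exists n.
  by exists k => //; left.
have /andP[us /allP st] := sP (size t).+1.
by have := uniq_leq_size us st; rewrite size_s ltnn.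
Qed.

(** A point at distance at most [e *+ n.+1] from [K] is within [e] of a point of
    a geodesic that is at distance at most [e *+ n] from [K], hence covered by
    induction.  The finite set is kept inside [P] so that the same lemma yields
    generators. *)
Lemma bounded_translates (R : realType) (G : groupType) (X : metricType R)
    (act : G -> X -> X) (K : set X) (e : R) (E P : set G) (n : nat) :
  geodesic_space X -> isometric_action act -> is_subgroup P ->
  0 <= e -> finite_set E -> E `<=` P ->
  (forall y z, K z -> mdist z y <= e -> translates act E K y) ->
  exists F, [/\ finite_set F, F `<=` P &
    forall y z, K z -> mdist z y <= e *+ n -> translates act F K y].
Proof.
move=> geo iso sP e0 finE EP EK; elim: n => [|n [F [finF FP FK]]].
  exists [set 1%g]; split=> [||y z Kz]; first exact: finite_set1.
    by move=> _ ->; exact: subgroup1.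
  rewrite mulr0n => zy; have -> : y = z.
    by apply/esym/mdist_positivity/eqP; rewrite eq_le zy mdist_ge0.
  by exists 1%g => //; exists z => //; exact: act_one.
exists [set (g * h)%g | g in F & h in E]; split.
- exact: finite_image2.
- by move=> _ [g Fg [h Eh <-]]; apply: subgroupM; auto.
move=> y z Kz zy; have [c [c0 cd cP]] := geo z y.
set d := mdist z y in zy cd cP *.
have d0 : 0 <= d by exact: mdist_ge0.
have en0 : 0 <= e *+ n by exact: mulrn_wge0.
pose r := Num.min (e *+ n) d.
have r0 : 0 <= r by rewrite le_min en0.
have rd : r <= d by rewrite ge_min lexx orbT.
have [|g Fg [k Kk gk]] := FK (c r) z Kz.
  rewrite -c0 cP ?in_itv /= ?lexx ?r0 ?d0//.
  by rewrite sub0r normrN ger0_norm// ge_min lexx.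
have [|h Eh [k' Kk' hk']] := EK (act g^-1%g y) k Kk.
  rewrite -mdist_act_inv// gk -cd cP ?in_itv /= ?lexx ?r0 ?d0//.
  rewrite distrC ger0_norm ?subr_ge0// lerBlDr.
  by rewrite /r; case: (leP (e *+ n) d) => _; rewrite ?lerDr// -mulrS.
exists (g * h)%g; first by exists g => //; exists h.
by exists k' => //; rewrite (act_mul iso) hk' act_Kinv.
Qed.

Lemma archi_mulrn (R : realType) (e M : R) : 0 < e -> exists n, M <= e *+ n.
Proof.
move=> e0; exists (Num.truncn (M / e)).+1.
rewrite -mulr_natr -ler_pdivrMl// mulrC ltW//; exact: truncnS_gt.
Qed.

(** The elements whose translates cover a thickening of [K], together with the
    returns to [K], generate [G]. *)
Lemma cocompact_finitely_generated (R : realType) (G : groupType)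
    (X : completeMetricType R) (act : G -> X -> X) :
  geodesic_space X -> isometric_action act -> properly_discontinuous act ->
  cocompact act -> exists2 T : set G, finite_set T & generates T.
Proof.
move=> geo iso pd [K [cK GK]].
have [e [E [e0 finE EK]]] := thickening_translates pd cK GK.
exists (E `|` returns act K).
  by rewrite finite_setU; split=> //; exact: pd.
move=> P sP; rewrite subUset => -[EP rP]; apply/seteqP; split=> // g _.
have [g0 _ [k Kk _]] : translates act setT K point.
  by rewrite /translates GK.
have [n kgk] := archi_mulrn (mdist k (act g k)) e0.
have [F [_ FP FK]] := bounded_translates n geo iso sP (ltW e0) finE EP EK.
have [p /FP Pp [k' Kk' pk']] := FK _ _ Kk kgk.
have /rP : returns act K (p^-1 * g)%g.
  exists k'; split=> //; exists k => //.
  by rewrite (act_mul iso) -pk' act_invK.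
by move=> /(subgroupM sP Pp); rewrite mulVKg.
Qed.

(** Conjugation moves the base point into [K]; there, [g] differs by a return to
    [K] from one of the translates covering a large ball. *)
Lemma finite_bounded_displacement (R : realType) (G : groupType)
    (X : completeMetricType R) (act : G -> X -> X) (x : X) (M : R) :
  geodesic_space X -> isometric_action act -> properly_discontinuous act ->
  cocompact act -> finite_set [set g | mdist x (act g x) <= M].
Proof.
move=> geo iso pd [K [cK GK]].
have [e [E [e0 finE EK]]] := thickening_translates pd cK GK.
have [n Mn] := archi_mulrn M e0.
have sT : is_subgroup [set: G] by exact/is_subgroupP.
have [F [finF _ FK]] := bounded_translates n geo iso sT (ltW e0) finE
  (@subsetT _ E) EK.
have [a _ [k Kk ak]] : translates act setT K x by rewrite /translates GK.
have finA : finite_set [set (p * q)%g | p in F & q in returns act K].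
  by apply: finite_image2 => //; exact: pd.
apply: sub_finite_set (finite_image (fun g => g ^ a^-1)%g finA) => g /= gM.
exists (g ^ a)%g; last by rewrite conjgK.
have [|p Fp [k' Kk' pk']] := FK (act (g ^ a)%g k) k Kk.
  apply: le_trans Mn; apply: le_trans gM.
  by rewrite conjgE !(act_mul iso) -mdist_act_inv// ak.
exists p => //; exists (p^-1 * g ^ a)%g; last by rewrite mulVKg.
exists k'; split=> //; exists k => //.
by rewrite (act_mul iso) -pk' act_invK.
Qed.

(** * Finite subgroups of cocompact groups *)

(** The centralizer preserves the set of fixed points of [H]. *)
Lemma finite_centralizer (R : realType) (G : groupType)
    (X : completeMetricType R) (act : G -> X -> X) (H : set G) :
  geodesic_space X -> isometric_action act -> properly_discontinuous act ->
  cocompact act -> fixed_points act H !=set0 ->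
  bounded_subset (fixed_points act H) ->
  finite_set [set c : G | forall h, H h -> (h ^ c = h)%g].
Proof.
move=> geo iso pd cc [x Hx] [M HM].
apply: sub_finite_set (finite_bounded_displacement x M geo iso pd cc) => c cH.
apply: HM => // h Hh.
by rewrite -(act_mul iso) conjgC cH// (act_mul iso) Hx.
Qed.

(** A finite subgroup fixes a point, which can be translated into the compact
    fundamental set [K]. *)
Lemma finite_subgroups_up_to_conjugacy (R : realType) (G : groupType)
    (X : completeMetricType R) (act : G -> X -> X) :
  CAT0_space X -> isometric_action act -> properly_discontinuous act ->
  cocompact act -> exists2 S : set G, finite_set S &
    forall A, is_subgroup A -> finite_set A ->
      exists g : G, forall a, A a -> S (a ^ g)%g.
Proof.
move=> cat iso pd [K [cK GK]]; exists (returns act K); first exact: pd.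
move=> A sA finA; have [x Ax] := finite_group_fixed_point cat iso sA finA.
have [g _ [k Kk gk]] : translates act setT K x by rewrite /translates GK.
exists g => a Aa; exists k; split=> //; exists k => //.
by rewrite conjgE !(act_mul iso) gk Ax// -gk act_invK.
Qed.

Lemma aut_image_subgroup (G : groupType) (a : Aut G) (H : set G) :
  is_subgroup H -> is_subgroup (a @` H).
Proof.
move=> sH; apply/is_subgroupP; split.
  by exists 1%g; [exact: subgroup1|exact: aut1].
move=> _ _ [x Hx <-] [y Hy <-]; exists (x / y)%g; first exact: subgroupF.
by rewrite autM autV.
Qed.

Theorem theorem2 (R : realType) (G : groupType) (X : completeMetricType R)
    (act : G -> X -> X)
    (G_rf : residually_finite G)
    (X_CAT0 : CAT0_space X)
    (act_isom : isometric_action act)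
    (act_pd : properly_discontinuous act)
    (act_cocompact : cocompact act)
    (exH : exists H : set G,
       [/\ is_subgroup H, finite_set H & bounded_subset (fixed_points act H)]) :
  splits_virtually (Aut_to_Out G) /\ residually_finite (Out G).
Proof.
have [geo _] := X_CAT0; have [H [sH finH bdH]] := exH.
have [T finT genT] :=
  cocompact_finitely_generated geo act_isom act_pd act_cocompact.
have [S finS SP] :=
  finite_subgroups_up_to_conjugacy X_CAT0 act_isom act_pd act_cocompact.
have sv : splits_virtually (Aut_to_Out G).
  apply: (splits_virtually_Aut_to_Out G_rf finT genT finH finS).
    move=> a; have [g gP] := SP _ (aut_image_subgroup a sH) (finite_image a finH).
    by exists g => h Hh; apply: gP; exists h.
  have fixH := finite_group_fixed_point X_CAT0 act_isom sH finH.
  exact: finite_centralizer geo act_isom act_pd act_cocompact fixH bdH.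
split=> //; apply: residually_finite_splits_virtually sv _.
exact: residually_finite_Aut finT genT G_rf.
Qed.
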